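(* Consider the Martinet flat sub-Riemannian structure on $\mathbb{M}=\mathbb{R}^3$ with coordinates $(x,y,z)=(x_1,x_2,x_3)$, with $$a^{\mathsf T}=\begin{pmatrix}1&0&\frac{y^2}{2}\\0&1&0\end{pmatrix},\qquad z^{\mathsf T}=(0,0,1),$$ a potential $V\in C^\infty(\mathbb{R}^3)$ and $\rho^*=\frac1ce^{-V}\mathrm{Vol}$ with $\mathrm{Vol}=e^{-y^2/2}$. Write $A_1f=\partial_xf+\frac{y^2}2\partial_zf$, $A_2f=\partial_yf$, $\mathsf Zf=\partial_zf$. For every $f\in C^\infty(\mathbb{M})$ one has $$\Gamma_2(f,f)+\Gamma_2^{z,\rho^*}(f,f)=|\mathfrak{Hess}^G_{a,z}f|^2+\mathfrak R_{ab}^G(\nabla f,\nabla f)+\mathfrak R_{zb}(\nabla f,\nabla f)+\mathfrak R_{\rho^*}(\nabla f,\nabla f),$$ where $$\Lambda_1^{\mathsf T}=\big(0,\tfrac{y\,\partial_zf}{2},0,\tfrac{y\,\partial_zf}{2},0,0,0,0,0\big),\qquad \Lambda_2^{\mathsf T}=\big(0,0,0,0,0,0,-y\,\partial_yf,\tfrac{y^3}{2}\partial_zf+y\,\partial_xf,0\big),$$ $$\begin{aligned}\mathfrak R_{ab}^G(\nabla f,\nabla f)=&\ \tfrac{y^2}{2}\Gamma_1^z(f,f)-y^2\Gamma_1(f,f)+\partial_zf\,A_1f+y(A_1V)\,\partial_zf\,A_2f+y\,\partial_zV\,A_1f\,A_2f\\&+\Big(\partial_x^2V+y^2\partial_x\partial_zV+\tfrac{y^4}{4}\partial_z^2V\Big)|A_1f|^2+2\Big(\partial_x\partial_yV+\tfrac{y^2}{2}\partial_y\partial_zV\Big)A_1f\,A_2f\\&+\partial_y^2V\,|A_2f|^2-y\,\partial_yV\,\partial_zf\,A_1f,\end{aligned}$$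 $$\mathfrak R_{zb}(\nabla f,\nabla f)=\Big(\partial_x\partial_zV+\tfrac{y^2}{2}\partial_z^2V\Big)A_1f\,\mathsf Zf+\partial_y\partial_zV\,A_2f\,\mathsf Zf,\qquad \mathfrak R_{\rho^*}(\nabla f,\nabla f)=0.$$
   Context: General notation (here $n=2$, $m=1$). $a$ is a smooth $3\times2$ matrix function and $z$ a smooth $3\times1$ matrix function on $\mathbb{R}^3$ (the matrix $z$ is not to be confused with the coordinate $z$). Write $\partial_p=\partial/\partial x_p$, $\alpha_{ip}=(a^{\mathsf T})_{ip}$, $\zeta_p=(z^{\mathsf T})_{1p}$; indices $i,k$ run over $\{1,2\}$ and $p,q,r,s$ over $\{1,2,3\}$; a derivative acts only on the factor immediately following it. $A_if=(a^{\mathsf T}\nabla)_if=\sum_p\alpha_{ip}\partial_pf$, $\mathsf Zf=(z^{\mathsf T}\nabla)_1f=\sum_p\zeta_p\partial_pf$. Generator: $Lf=\nabla\cdot(aa^{\mathsf T}\nabla f)-\langle a\otimes\nabla a,\nabla f\rangle-\langle\nabla V,aa^{\mathsf T}\nabla f\rangle$, with $(a\otimes\nabla a)_p=\sum_{k}\sum_{q}\alpha_{kp}\partial_q\alpha_{kq}$. In $\rho^*=\frac1ce^{-V}\mathrm{Vol}$, $c=\int e^{-V}\mathrm{Vol}\,dx<\infty$ is the normalization constant. Gamma forms: $\Gamma_1(f,g)=\sum_iA_if\,A_ig$, $\Gamma_1^z(f,g)=\mathsf Zf\,\mathsf Zg$, $\Gamma_2(f,f)=\frac12[L\Gamma_1(f,f)-2\Gamma_1(Lf,f)]$,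 and $$\Gamma_2^{z,\rho^*}(f,f)=\tfrac12[L\Gamma_1^z(f,f)-2\Gamma_1^z(Lf,f)]+\tfrac1{\rho^*}\nabla\cdot\big(\rho^*zz^{\mathsf T}\langle\nabla f,\nabla(aa^{\mathsf T})\nabla f\rangle\big)-\tfrac1{\rho^*}\nabla\cdot\big(\rho^*aa^{\mathsf T}\langle\nabla f,\nabla(zz^{\mathsf T})\nabla f\rangle\big),$$ where $\langle\nabla f,\nabla(M)\nabla f\rangle$ denotes the vector with $p$-th component $\langle\nabla f,(\partial_pM)\nabla f\rangle$. Matrices and vectors: pairs $(p,q)$ are ordered lexicographically. $X\in\mathbb{R}^9$ has entries $X_{pq}=\partial_p\partial_qf$. $Q\in\mathbb{R}^{4\times9}$ has entries $Q_{(i,k),(p,q)}=\alpha_{ip}\alpha_{kq}$ (rows $(i,k)$ in lexicographic order). $P\in\mathbb{R}^{2\times9}$ has entries $P_{k,(p,q)}=\zeta_p\alpha_{kq}$. $D\in\mathbb{R}^4$: $D_{ik}=\sum_{p,r}\alpha_{ip}\,\partial_p\alpha_{kr}\,\partial_rf$. $E\in\mathbb{R}^2$: $E_i=\sum_{p,r}\alpha_{ip}\,\partial_p\zeta_r\,\partial_rf$. For given $\Lambda_1,\Lambda_2\in\mathbb{R}^9$, $$|\mathfrak{Hess}^G_{a,z}f|^2=(X+\Lambda_1)^{\mathsf T}Q^{\mathsf T}Q(X+\Lambda_1)+(X+\Lambda_2)^{\mathsf T}P^{\mathsf T}P(X+\Lambda_2).$$ Tensors: $\mathfrak R^G_{ab}(\nabla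 f,\nabla f)=\mathfrak R_{ab}(\nabla f,\nabla f)-\Lambda_1^{\mathsf T}Q^{\mathsf T}Q\Lambda_1-\Lambda_2^{\mathsf T}P^{\mathsf T}P\Lambda_2+D^{\mathsf T}D+E^{\mathsf T}E$. Let $b=-\frac12aa^{\mathsf T}\nabla V$. Then $$\mathfrak R_{ab}(\nabla f,\nabla f)=\sum_{i,k}\sum_{p,q,r}\big[\alpha_{ip}\partial_p\alpha_{iq}\,\partial_q\alpha_{kr}\,\partial_rf+\alpha_{ip}\alpha_{iq}(\partial_p\partial_q\alpha_{kr})\partial_rf-\alpha_{kr}\partial_r\alpha_{ip}\,\partial_p\alpha_{iq}\,\partial_qf-\alpha_{kr}\alpha_{ip}(\partial_r\partial_p\alpha_{iq})\partial_qf\big]A_kf-2\sum_i\sum_{q,r}\big(\alpha_{iq}\partial_qb_r\,\partial_rf-b_r\partial_r\alpha_{iq}\,\partial_qf\big)A_if,$$ $$\mathfrak R_{zb}(\nabla f,\nabla f)=\sum_i\sum_{p,q,r}\big[\alpha_{ip}\partial_p\alpha_{iq}\,\partial_q\zeta_r\,\partial_rf+\alpha_{ip}\alpha_{iq}(\partial_p\partial_q\zeta_r)\partial_rf-\zeta_r\partial_r\alpha_{ip}\,\partial_p\alpha_{iq}\,\partial_qf-\zeta_r\alpha_{ip}(\partial_r\partial_p\alpha_{iq})\partial_qf\big]\mathsf Zf-2\sum_{q,r}\big(\zeta_q\partial_qb_r\,\partial_rf-b_r\partial_r\zeta_q\,\partial_qf\big)\mathsf Zf,$$ $$\begin{aligned}\mathfrak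 R_{\rho^*}(\nabla f,\nabla f)=&\ 2\sum_i\sum_{p,q,r,s}\big[(\partial_p\zeta_p)\zeta_q(\partial_q\alpha_{ir})\alpha_{is}+\zeta_p(\partial_p\zeta_q)(\partial_q\alpha_{ir})\alpha_{is}+\zeta_p\zeta_q(\partial_p\partial_q\alpha_{ir})\alpha_{is}+\zeta_p\zeta_q(\partial_q\alpha_{ir})(\partial_p\alpha_{is})\big]\partial_rf\,\partial_sf\\&+2\sum_i\sum_{q,r,s}(\mathsf Z\log\rho^* )\zeta_q(\partial_q\alpha_{ir})\alpha_{is}\,\partial_rf\,\partial_sf\\&-2\sum_i\sum_{p,q,r,s}\big[(\partial_p\alpha_{ip})\alpha_{iq}(\partial_q\zeta_r)\zeta_s+\alpha_{ip}(\partial_p\alpha_{iq})(\partial_q\zeta_r)\zeta_s+\alpha_{ip}\alpha_{iq}(\partial_p\partial_q\zeta_r)\zeta_s+\alpha_{ip}\alpha_{iq}(\partial_q\zeta_r)(\partial_p\zeta_s)\big]\partial_rf\,\partial_sf\\&-2\sum_i\sum_{q,r,s}(A_i\log\rho^* )\alpha_{iq}(\partial_q\zeta_r)\zeta_s\,\partial_rf\,\partial_sf.\end{aligned}$$ *)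

(* Defs.v *)
From HB Require Import structures.
From mathcomp Require Import all_boot all_order all_algebra.
From mathcomp Require Import all_classical all_reals all_analysis.

Set Implicit Arguments.
Unset Strict Implicit.
Unset Printing Implicit Defensive.
Import Order.TTheory GRing.Theory Num.Theory.
Import numFieldNormedType.Exports.
Local Open Scope classical_set_scope.
Local Open Scope ring_scope.

(* Coordinates are 0-based: x_1, x_2, x_3 of R^3 are x 0 0, x 0 1, x 0 2, and
   every index range {1, ..., n} becomes 'I_n. *)
Notation ix := (@inord 2 0) (only parsing).
Notation iy := (@inord 2 1) (only parsing).
Notation iz := (@inord 2 2) (only parsing).

Definition pd (R : realType) (p : 'I_3) (f : 'rV[R]_3 -> R) : 'rV[R]_3 -> R :=
  fun x => 'D_(delta_mx 0 p) f x.

(* C^oo: every iterated partial derivative exists and is continuous. *)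
Definition smooth (R : realType) (f : 'rV[R]_3 -> R) : Prop :=
  forall s : seq 'I_3,
    let g := foldr (@pd R) f s in
    continuous g /\ forall (p : 'I_3) (x : 'rV[R]_3), derivable g x (delta_mx 0 p).

Definition grad (R : realType) (f : 'rV[R]_3 -> R) (x : 'rV[R]_3) : 'cV[R]_3 :=
  \col_p pd p f x.

Definition div (R : realType) (F : 'rV[R]_3 -> 'cV[R]_3) (x : 'rV[R]_3) : R :=
  \sum_(p < 3) pd p (fun w => F w p 0) x.

Definition dmx (R : realType) (p : 'I_3) (M : 'rV[R]_3 -> 'M[R]_3)
    (x : 'rV[R]_3) : 'M[R]_3 :=
  \matrix_(i, j) pd p (fun w => M w i j) x.

Definition dot (R : realType) n (u v : 'cV[R]_n) : R := (u^T *m v) 0 0.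

Definition al (R : realType) (a : 'rV[R]_3 -> 'M[R]_(3, 2)) (i : 'I_2) (p : 'I_3)
    : 'rV[R]_3 -> R :=
  fun x => (a x)^T i p.

Definition ze (R : realType) (z : 'rV[R]_3 -> 'cV[R]_3) (p : 'I_3)
    : 'rV[R]_3 -> R :=
  fun x => (z x)^T 0 p.

Definition fA (R : realType) (a : 'rV[R]_3 -> 'M[R]_(3, 2)) (i : 'I_2)
    (f : 'rV[R]_3 -> R) : 'rV[R]_3 -> R :=
  fun x => ((a x)^T *m grad f x) i 0.

Definition fZ (R : realType) (z : 'rV[R]_3 -> 'cV[R]_3)
    (f : 'rV[R]_3 -> R) : 'rV[R]_3 -> R :=
  fun x => ((z x)^T *m grad f x) 0 0.

(* the vector written a \otimes \nabla a *)
Definition atensor (R : realType) (a : 'rV[R]_3 -> 'M[R]_(3, 2)) (x : 'rV[R]_3)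
    : 'cV[R]_3 :=
  \col_p \sum_(k < 2) \sum_(q < 3) al a k p x * pd q (al a k q) x.

Definition generator (R : realType) (a : 'rV[R]_3 -> 'M[R]_(3, 2))
    (V f : 'rV[R]_3 -> R) : 'rV[R]_3 -> R :=
  fun x => div (fun w => a w *m (a w)^T *m grad f w) x
         - dot (atensor a x) (grad f x)
         - dot (grad V x) (a x *m (a x)^T *m grad f x).

Definition Gamma1 (R : realType) (a : 'rV[R]_3 -> 'M[R]_(3, 2))
    (f g : 'rV[R]_3 -> R) : 'rV[R]_3 -> R :=
  fun x => \sum_(i < 2) fA a i f x * fA a i g x.

Definition Gamma1z (R : realType) (z : 'rV[R]_3 -> 'cV[R]_3)
    (f g : 'rV[R]_3 -> R) : 'rV[R]_3 -> R :=
  fun x => fZ z f x * fZ z g x.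

Definition Gamma2 (R : realType) (a : 'rV[R]_3 -> 'M[R]_(3, 2))
    (V f : 'rV[R]_3 -> R) : 'rV[R]_3 -> R :=
  fun x => 2^-1 * (generator a V (Gamma1 a f f) x
                   - 2 * Gamma1 a (generator a V f) f x).

(* <nabla f, nabla(M) nabla f> *)
Definition dquad (R : realType) (M : 'rV[R]_3 -> 'M[R]_3) (f : 'rV[R]_3 -> R)
    (x : 'rV[R]_3) : 'cV[R]_3 :=
  \col_p dot (grad f x) (dmx p M x *m grad f x).

Definition Gamma2z (R : realType) (a : 'rV[R]_3 -> 'M[R]_(3, 2))
    (z : 'rV[R]_3 -> 'cV[R]_3) (V rho f : 'rV[R]_3 -> R) : 'rV[R]_3 -> R :=
  let aaT := fun w => a w *m (a w)^T in
  let zzT := fun w => z w *m (z w)^T in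
  fun x => 2^-1 * (generator a V (Gamma1z z f f) x
                   - 2 * Gamma1z z (generator a V f) f x)
         + (rho x)^-1 * div (fun w => rho w *: (zzT w *m dquad aaT f w)) x
         - (rho x)^-1 * div (fun w => rho w *: (aaT w *m dquad zzT f w)) x.

(* Pairs in lexicographic order: the pair (p, q) of 'I_3 x 'I_3 has number
   3 * p + q in 'I_9, the pair (i, k) of 'I_2 x 'I_2 has number 2 * i + k
   in 'I_4. *)
Definition fst3 (u : 'I_9) : 'I_3 := inord (u %/ 3).
Definition snd3 (u : 'I_9) : 'I_3 := inord (u %% 3).
Definition fst2 (u : 'I_4) : 'I_2 := inord (u %/ 2).
Definition snd2 (u : 'I_4) : 'I_2 := inord (u %% 2).

Definition Xvec (R : realType) (f : 'rV[R]_3 -> R) (x : 'rV[R]_3) : 'cV[R]_9 :=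
  \col_u pd (fst3 u) (pd (snd3 u) f) x.

Definition Qmx (R : realType) (a : 'rV[R]_3 -> 'M[R]_(3, 2)) (x : 'rV[R]_3)
    : 'M[R]_(4, 9) :=
  \matrix_(u, v) (al a (fst2 u) (fst3 v) x * al a (snd2 u) (snd3 v) x).

Definition Pmx (R : realType) (a : 'rV[R]_3 -> 'M[R]_(3, 2))
    (z : 'rV[R]_3 -> 'cV[R]_3) (x : 'rV[R]_3) : 'M[R]_(2, 9) :=
  \matrix_(k, v) (ze z (fst3 v) x * al a k (snd3 v) x).

Definition Dvec (R : realType) (a : 'rV[R]_3 -> 'M[R]_(3, 2))
    (f : 'rV[R]_3 -> R) (x : 'rV[R]_3) : 'cV[R]_4 :=
  \col_u \sum_(p < 3) \sum_(r < 3)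
    al a (fst2 u) p x * pd p (al a (snd2 u) r) x * pd r f x.

Definition Evec (R : realType) (a : 'rV[R]_3 -> 'M[R]_(3, 2))
    (z : 'rV[R]_3 -> 'cV[R]_3) (f : 'rV[R]_3 -> R) (x : 'rV[R]_3) : 'cV[R]_2 :=
  \col_i \sum_(p < 3) \sum_(r < 3) al a i p x * pd p (ze z r) x * pd r f x.

(* |Hess^G_{a,z} f|^2 *)
Definition HessG2 (R : realType) (a : 'rV[R]_3 -> 'M[R]_(3, 2))
    (z : 'rV[R]_3 -> 'cV[R]_3) (L1 L2 : 'rV[R]_3 -> 'cV[R]_9)
    (f : 'rV[R]_3 -> R) (x : 'rV[R]_3) : R :=
  let X := Xvec f x in let Q := Qmx a x in let P := Pmx a z x in
  ((X + L1 x)^T *m Q^T *m Q *m (X + L1 x)) 0 0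
  + ((X + L2 x)^T *m P^T *m P *m (X + L2 x)) 0 0.

Definition drift (R : realType) (a : 'rV[R]_3 -> 'M[R]_(3, 2))
    (V : 'rV[R]_3 -> R) (r : 'I_3) : 'rV[R]_3 -> R :=
  fun x => ((- 2^-1) *: (a x *m (a x)^T *m grad V x)) r 0.

Definition Rab (R : realType) (a : 'rV[R]_3 -> 'M[R]_(3, 2))
    (V f : 'rV[R]_3 -> R) (x : 'rV[R]_3) : R :=
  let b := drift a V in
  \sum_(i < 2) \sum_(k < 2) \sum_(p < 3) \sum_(q < 3) \sum_(r < 3)
    ((  al a i p x * pd p (al a i q) x * pd q (al a k r) x * pd r f x
      + al a i p x * al a i q x * pd p (pd q (al a k r)) x * pd r f x
      - al a k r x * pd r (al a i p) x * pd p (al a i q) x * pd q f x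
      - al a k r x * al a i p x * pd r (pd p (al a i q)) x * pd q f x)
     * fA a k f x)
  - 2 * \sum_(i < 2) \sum_(q < 3) \sum_(r < 3)
    ((al a i q x * pd q (b r) x * pd r f x
      - b r x * pd r (al a i q) x * pd q f x) * fA a i f x).

Definition RabG (R : realType) (a : 'rV[R]_3 -> 'M[R]_(3, 2))
    (z : 'rV[R]_3 -> 'cV[R]_3) (V : 'rV[R]_3 -> R)
    (L1 L2 : 'rV[R]_3 -> 'cV[R]_9) (f : 'rV[R]_3 -> R) (x : 'rV[R]_3) : R :=
  let Q := Qmx a x in let P := Pmx a z x in
  Rab a V f x
  - ((L1 x)^T *m Q^T *m Q *m L1 x) 0 0
  - ((L2 x)^T *m P^T *m P *m L2 x) 0 0
  + dot (Dvec a f x) (Dvec a f x)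
  + dot (Evec a z f x) (Evec a z f x).

Definition Rzb (R : realType) (a : 'rV[R]_3 -> 'M[R]_(3, 2))
    (z : 'rV[R]_3 -> 'cV[R]_3) (V f : 'rV[R]_3 -> R) (x : 'rV[R]_3) : R :=
  let b := drift a V in
  \sum_(i < 2) \sum_(p < 3) \sum_(q < 3) \sum_(r < 3)
    ((  al a i p x * pd p (al a i q) x * pd q (ze z r) x * pd r f x
      + al a i p x * al a i q x * pd p (pd q (ze z r)) x * pd r f x
      - ze z r x * pd r (al a i p) x * pd p (al a i q) x * pd q f x
      - ze z r x * al a i p x * pd r (pd p (al a i q)) x * pd q f x)
     * fZ z f x)
  - 2 * \sum_(q < 3) \sum_(r < 3)
    ((ze z q x * pd q (b r) x * pd r f x
      - b r x * pd r (ze z q) x * pd q f x) * fZ z f x).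

Definition Rrho (R : realType) (a : 'rV[R]_3 -> 'M[R]_(3, 2))
    (z : 'rV[R]_3 -> 'cV[R]_3) (rho f : 'rV[R]_3 -> R) (x : 'rV[R]_3) : R :=
  let logrho := fun w => ln (rho w) in
  2 * \sum_(i < 2) \sum_(p < 3) \sum_(q < 3) \sum_(r < 3) \sum_(s < 3)
    ((  pd p (ze z p) x * ze z q x * pd q (al a i r) x * al a i s x
      + ze z p x * pd p (ze z q) x * pd q (al a i r) x * al a i s x
      + ze z p x * ze z q x * pd p (pd q (al a i r)) x * al a i s x
      + ze z p x * ze z q x * pd q (al a i r) x * pd p (al a i s) x)
     * pd r f x * pd s f x)
  + 2 * \sum_(i < 2) \sum_(q < 3) \sum_(r < 3) \sum_(s < 3)
    (fZ z logrho x * ze z q x * pd q (al a i r) x * al a i s x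
     * pd r f x * pd s f x)
  - 2 * \sum_(i < 2) \sum_(p < 3) \sum_(q < 3) \sum_(r < 3) \sum_(s < 3)
    ((  pd p (al a i p) x * al a i q x * pd q (ze z r) x * ze z s x
      + al a i p x * pd p (al a i q) x * pd q (ze z r) x * ze z s x
      + al a i p x * al a i q x * pd p (pd q (ze z r)) x * ze z s x
      + al a i p x * al a i q x * pd q (ze z r) x * pd p (ze z s) x)
     * pd r f x * pd s f x)
  - 2 * \sum_(i < 2) \sum_(q < 3) \sum_(r < 3) \sum_(s < 3)
    (fA a i logrho x * al a i q x * pd q (ze z r) x * ze z s x
     * pd r f x * pd s f x).

(* The library has Lebesgue measure on R only; R^3 carries the product
   measure, transported along (x, y, z) |-> point3 x y z. *)
Definition point3 (R : realType) (x y z : R) : 'rV[R]_3 :=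
  \row_(p < 3) nth 0 [:: x; y; z] p.

(* c = int_{R^3} e^{-V} Vol dx, possibly +oo. *)
Definition norm_const (R : realType) (V Vol : 'rV[R]_3 -> R) : \bar R :=
  (\int[(lebesgue_measure \x lebesgue_measure) \x lebesgue_measure]_(w in
        [set: (measurableTypeR R * measurableTypeR R) * measurableTypeR R])
     (let x := point3 w.1.1 w.1.2 w.2 in expR (- V x) * Vol x)%:E)%E.

Definition rho_star (R : realType) (V Vol : 'rV[R]_3 -> R) : 'rV[R]_3 -> R :=
  fun x => (fine (norm_const V Vol))^-1 * expR (- V x) * Vol x.

Definition martinet_a (R : realType) (x : 'rV[R]_3) : 'M[R]_(3, 2) :=
  let y := x 0 iy in
  (\matrix_(i < 2, p < 3)
     nth 0 (nth [::] [:: [:: 1; 0; y ^+ 2 / 2];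
                         [:: 0; 1; 0]] i) p)^T.

Definition martinet_z (R : realType) (x : 'rV[R]_3) : 'cV[R]_3 :=
  (\row_(p < 3) nth 0 [:: 0; 0; 1] p)^T.

Definition martinet_vol (R : realType) (x : 'rV[R]_3) : R :=
  expR (- (x 0 iy ^+ 2 / 2)).

Definition martinet_Lambda1 (R : realType) (f : 'rV[R]_3 -> R) (x : 'rV[R]_3)
    : 'cV[R]_9 :=
  let y := x 0 iy in
  (\row_(u < 9) nth 0 [:: 0; y * pd iz f x / 2; 0;
                          y * pd iz f x / 2; 0; 0;
                          0; 0; 0] u)^T.

Definition martinet_Lambda2 (R : realType) (f : 'rV[R]_3 -> R) (x : 'rV[R]_3)
    : 'cV[R]_9 :=
  let y := x 0 iy in
  (\row_(u < 9) nth 0 [:: 0; 0; 0;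
                          0; 0; 0;
                          - (y * pd iy f x);
                          y ^+ 3 / 2 * pd iz f x + y * pd ix f x;
                          0] u)^T.

Definition martinet_A1 (R : realType) (f : 'rV[R]_3 -> R) (x : 'rV[R]_3) : R :=
  pd ix f x + x 0 iy ^+ 2 / 2 * pd iz f x.

Definition martinet_A2 (R : realType) (f : 'rV[R]_3 -> R) (x : 'rV[R]_3) : R :=
  pd iy f x.

Definition martinet_Z (R : realType) (f : 'rV[R]_3 -> R) (x : 'rV[R]_3) : R :=
  pd iz f x.

(* Main.v *)
Require Import Defs.
From HB Require Import structures.
From mathcomp Require Import all_boot all_order all_algebra.
From mathcomp Require Import all_classical all_reals all_analysis.
From mathcomp Require Import ring lra.
Import Order.TTheory GRing.Theory Num.Theory.
Import numFieldNormedType.Exports.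
Local Open Scope ring_scope.

(* Write A1, A2, Z for the three vector fields.  They are derivations of the
   smooth functions with [A2, A1] = y Z and [A1, Z] = [A2, Z] = 0, and
   L = A1^2 + A2^2 - (A1 V) A1 - (A2 V) A2.  For W = A1, A2, Z, with u = W f,
     (1/2) L (u^2) - u W (L f) = (A1 u)^2 + (A2 u)^2 + u [L, W] f,
   and summing over W gives a Bochner formula whose third-order terms cancel.
   The density terms vanish because a does not depend on x_3 and z is constant,
   so neither the value nor the finiteness of the constant c matters.  What
   remains is to compare polynomials in the 2-jets of f and V, using the
   symmetry of second derivatives. *)

(** * Smooth functions *)

Lemma smooth_continuous (R : realType) (f : 'rV[R]_3 -> R) :
  smooth f -> continuous f.
Proof. by move=> /(_ [::]) []. Qed.

Lemma smooth_derivable (R : realType) (f : 'rV[R]_3 -> R) (p : 'I_3) x :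
  smooth f -> derivable f x (delta_mx 0 p).
Proof. by move=> /(_ [::]) [] _; apply. Qed.

(** [foldr] applies the last letter of a word first, so differentiating by [p] beforehand appends
    [p] to the word. *)
Lemma smooth_pd (R : realType) (f : 'rV[R]_3 -> R) (p : 'I_3) :
  smooth f -> smooth (pd p f).
Proof. by move=> fs s; have := fs (rcons s p); rewrite foldr_rcons. Qed.

(** Coinduction principle: stability carries [P] along every word of partial derivatives, and at its
    end [P] gives continuity and derivability. *)
Lemma smooth_coind (R : realType) (P : ('rV[R]_3 -> R) -> Prop) :
  (forall f, P f -> continuous f) ->
  (forall f p x, P f -> derivable f x (delta_mx 0 p)) ->
  (forall f p, P f -> P (pd p f)) ->
  forall f, P f -> smooth f.
Proof.
move=> Pc Pd Ppd f Pf s.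
have : P (foldr (@pd R) f s) by elim: s => //= p s; apply: Ppd.
by move=> Pg; split; [exact: Pc|move=> p x; exact: Pd].
Qed.

Lemma pdD (R : realType) (f g : 'rV[R]_3 -> R) (p : 'I_3) :
  smooth f -> smooth g -> pd p (f + g) = pd p f + pd p g.
Proof.
by move=> fs gs; apply/funext => x; apply: deriveD; exact: smooth_derivable.
Qed.

Lemma pdM (R : realType) (f g : 'rV[R]_3 -> R) (p : 'I_3) :
  smooth f -> smooth g -> pd p (f * g) = pd p f * g + f * pd p g.
Proof.
move=> fs gs; apply/funext => x.
rewrite /pd deriveM; [|exact: smooth_derivable..].
by rewrite addrC mulrC.
Qed.

Lemma pdN (R : realType) (f : 'rV[R]_3 -> R) (p : 'I_3) :
  smooth f -> pd p (- f) = - pd p f.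
Proof.
by move=> fs; apply/funext => x; apply: deriveN; exact: smooth_derivable.
Qed.

Lemma pd_cst (R : realType) (c : R) (p : 'I_3) :
  pd p (cst c : 'rV[R]_3 -> R) = cst 0.
Proof. by apply/funext => x; exact: derive_cst. Qed.

Lemma smooth_cst (R : realType) (c : R) : smooth (cst c : 'rV[R]_3 -> R).
Proof.
(* All constants are taken at once, since differentiation moves [cst c] to [cst 0]. *)
apply: (@smooth_coind _ (fun f => exists c, f = cst c)); last by exists c.
- by move=> _ [d ->] x; exact: cst_continuous.
- by move=> _ p x [d ->]; exact: derivable_cst.
- by move=> _ p [d ->]; exists 0; exact: pd_cst.
Qed.

Definition coord (R : realType) (j : 'I_3) : 'rV[R]_3 -> R := fun w => w 0 j.

Lemma is_derive_coord (R : realType) (j : 'I_3) (x v : 'rV[R]_3) :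
  is_derive x v (coord R j) (v 0 j).
Proof.
suff dl : (h^-1 *: ((coord R j \o shift x) (h *: v) - coord R j x)
    @[h --> 0^'] --> v 0 j)%classic.
  by split; [apply/cvg_ex; exists (v 0 j)|exact: cvg_lim].
(* By linearity the difference quotient equals [v 0 j] for every nonzero [h]. *)
apply: cvg_near_cst; near=> h.
have h0 : h != 0 by near: h; exact: nbhs_dnbhs_neq.
by rewrite /coord /= !mxE addrK /GRing.scale /= mulKf.
Unshelve. all: by end_near. Qed.

Lemma pd_coord (R : realType) (p j : 'I_3) :
  pd p (coord R j) = cst (p == j)%:R.
Proof.
apply/funext => x; rewrite /pd.
have -> := @derive_val _ _ _ _ _ _ _ (is_derive_coord R j x (delta_mx 0 p)).
by rewrite mxE eqxx /= eq_sym.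
Qed.

(* Closing the smooth functions under the ring operations makes them stable
   under pd by the Leibniz rule, whence smooth by coinduction. *)
Inductive smooth_ring (R : realType) : ('rV[R]_3 -> R) -> Prop :=
| smooth_ring_gen f : smooth f -> smooth_ring R f
| smooth_ring_coord j : smooth_ring R (coord R j)
| smooth_ringN f : smooth_ring R f -> smooth_ring R (- f)
| smooth_ringD f g : smooth_ring R f -> smooth_ring R g -> smooth_ring R (f + g)
| smooth_ringM f g : smooth_ring R f -> smooth_ring R g -> smooth_ring R (f * g).

Lemma smooth_ring_smooth (R : realType) (f : 'rV[R]_3 -> R) :
  smooth_ring R f -> smooth f.
Proof.
(* Derivability comes first: the sum and product rules below rest on it before smoothness is
   known. *)
have Pd (g : 'rV[R]_3 -> R) (p : 'I_3) x : smooth_ring R g ->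
  derivable g x (delta_mx 0 p).
  elim=> {g} [g gs|j|g _ dg|g h _ dg _ dh|g h _ dg _ dh].
  - exact: smooth_derivable.
  - exact: (@ex_derive _ _ _ _ _ _ _ (is_derive_coord R j x (delta_mx 0 p))).
  - exact: derivableN.
  - exact: derivableD.
  - exact: derivableM.
apply: smooth_coind => //.
- move=> g; elim=> {g} [g gs|j|g _ cg|g h _ cg _ ch|g h _ cg _ ch] x.
  + exact: smooth_continuous.
  + exact: coord_continuous.
  + by apply: continuousN; exact: cg.
  + by apply: continuousD; [exact: cg|exact: ch].
  + by apply: continuousM; [exact: cg|exact: ch].
- move=> g p; elim=> {g} [g gs|j|g Pg dg|g h Pg dg Ph dh|g h Pg dg Ph dh].
  + exact/smooth_ring_gen/smooth_pd.
  + by rewrite pd_coord; apply/smooth_ring_gen/smooth_cst.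
  + have -> : pd p (- g) = - pd p g.
      by apply/funext => x; exact: deriveN (Pd _ _ _ Pg).
    exact: smooth_ringN.
  + have -> : pd p (g + h) = pd p g + pd p h.
      by apply/funext => x; exact: deriveD (Pd _ _ _ Pg) (Pd _ _ _ Ph).
    exact: smooth_ringD.
  + have -> : pd p (g * h) = g * pd p h + h * pd p g.
      by apply/funext => x; exact: deriveM (Pd _ _ _ Pg) (Pd _ _ _ Ph).
    by apply: smooth_ringD; apply: smooth_ringM.
Qed.

Lemma smooth_coord (R : realType) (j : 'I_3) :
  smooth (coord R j).
Proof. exact/smooth_ring_smooth/smooth_ring_coord. Qed.

Lemma smoothN (R : realType) (f : 'rV[R]_3 -> R) : smooth f -> smooth (- f).
Proof.
by move=> fs; apply/smooth_ring_smooth/smooth_ringN; exact: smooth_ring_gen.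
Qed.

Lemma smoothD (R : realType) (f g : 'rV[R]_3 -> R) :
  smooth f -> smooth g -> smooth (f + g).
Proof.
by move=> fs gs; apply/smooth_ring_smooth/smooth_ringD; exact: smooth_ring_gen.
Qed.

Lemma smoothM (R : realType) (f g : 'rV[R]_3 -> R) :
  smooth f -> smooth g -> smooth (f * g).
Proof.
by move=> fs gs; apply/smooth_ring_smooth/smooth_ringM; exact: smooth_ring_gen.
Qed.

(** * Symmetry of second derivatives *)

(** Passes to one variable, where the mean value theorem applies: the two difference quotients are
    the same function of [h]. *)
Lemma is_derive_line (R : realType) (g : 'rV[R]_3 -> R) (u v : 'rV[R]_3)
    (t : R) :
  derivable g (u + t *: v) v ->
  is_derive t 1 (fun s => g (u + s *: v)) ('D_v g (u + t *: v)).
Proof.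
have E : (fun h : R => h^-1 *: (((fun s => g (u + s *: v)) \o shift t) (h *: 1)
             - g (u + t *: v)))
    = (fun h => h^-1 *: ((g \o shift (u + t *: v)) (h *: v) - g (u + t *: v))).
  apply/funext => h /=; congr (_ *: (g _ - _)).
  by rewrite -[h *: 1]/(h * 1) mulr1 scalerDl addrCA.
by move=> dg; split; rewrite /derivable /derive E.
Qed.

(* The second difference of [f] over a square of side [h], computed by two
   applications of the mean value theorem; exchanging [p] and [q] leaves it
   unchanged. *)
Lemma second_difference (R : realType) (f : 'rV[R]_3 -> R) (p q : 'I_3)
    (x : 'rV[R]_3) (h : R) :
  smooth f -> 0 < h ->
  exists s t, [/\ 0 < s < h, 0 < t < h &
    f (x + h *: delta_mx 0 p + h *: delta_mx 0 q)
    - f (x + h *: delta_mx 0 p) - f (x + h *: delta_mx 0 q) + f x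
    = pd q (pd p f) (x + s *: delta_mx 0 p + t *: delta_mx 0 q) * h * h].
Proof.
move=> fs h0; set d := fun i : 'I_3 => (delta_mx 0 i : 'rV[R]_3).
rewrite -![delta_mx 0 _]/(d _).
(* [F] is the increment of [f] along [q], as a function of the displacement along [p]; the second
   difference is [F h - F 0]. *)
pose F (s : R) := f (x + h *: d q + s *: d p) - f (x + s *: d p).
pose dF (s : R) := pd p f (x + h *: d q + s *: d p) - pd p f (x + s *: d p).
have dFE (s : R) : is_derive s 1 F (dF s).
  by apply: is_deriveB; apply: is_derive_line; exact: smooth_derivable.
have [|s sI Fs] := @MVT R F dF 0 h h0 (fun s _ => dFE s).
  apply: derivable_within_continuous => s _.
  exact: (@ex_derive _ _ _ _ _ _ _ (dFE s)).
(* For the [s] just found, [dF s] is again an increment, namely [G h - G 0]. *)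
pose G (t : R) := pd p f (x + s *: d p + t *: d q).
pose dG (t : R) := pd q (pd p f) (x + s *: d p + t *: d q).
have dGE (t : R) : is_derive t 1 G (dG t).
  by apply: is_derive_line; exact/smooth_derivable/smooth_pd.
have [|t tI Gt] := @MVT R G dG 0 h h0 (fun t _ => dGE t).
  apply: derivable_within_continuous => t _.
  exact: (@ex_derive _ _ _ _ _ _ _ (dGE t)).
exists s, t; split; [by move: sI; rewrite in_itv|by move: tI; rewrite in_itv|].
move: Fs Gt; rewrite /F /dF /G /dG !scale0r !addr0 subr0.
rewrite [x + h *: d q + h *: d p]addrAC [x + h *: d q + s *: d p]addrAC.
by move=> Fs Gt; rewrite -Gt -Fs; ring.
Qed.

Lemma dist_le_of_common (R : realFieldType) (e u v w w' : R) :
  `|u - w| < e / 2 -> `|v - w'| < e / 2 -> w' = w -> `|u - v| <= e.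
Proof.
rewrite !ltr_distl ler_distl => /andP[? ?] /andP[? ?] ww'.
by apply/andP; split; lra.
Qed.

(** Schwarz: the second difference over a small square is either mixed derivative at some point of
    the square, times the squared side. Continuity at [x] then makes the two agree within any
    [e]. *)
Lemma pdC (R : realType) (f : 'rV[R]_3 -> R) (p q : 'I_3) :
  smooth f -> pd p (pd q f) = pd q (pd p f).
Proof.
move=> fs; apply/funext => x; apply/eqP; rewrite -subr_eq0 -normr_le0.
apply/ler_addgt0Pr => e e0; rewrite add0r.
have near_x g : smooth g -> \forall w \near x, `|g x - g w| < e / 2.
  move=> /smooth_continuous /(_ x) /cvgrPdist_lt; apply.
  by rewrite divr_gt0.
have [k k0 kx] : exists2 k : R, 0 < k & forall w, `|w - x| < k ->
    `|pd p (pd q f) x - pd p (pd q f) w| < e / 2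
    /\ `|pd q (pd p f) x - pd q (pd p f) w| < e / 2.
  have c1 := near_x _ (smooth_pd _ _ p (smooth_pd _ _ q fs)).
  have c2 := near_x _ (smooth_pd _ _ q (smooth_pd _ _ p fs)).
  have [k /= k0 kx] := (nbhs_normP x _).1 (filterI c1 c2).
  exists k => // w wx; apply: kx.
  by rewrite /ball_ /= distrC.
(* The side is half of [k] because a point of the square is displaced by at most [s + t]. *)
have h0 : 0 < k / 2 by rewrite divr_gt0.
have near_h (i j : 'I_3) s t : 0 < s < k / 2 -> 0 < t < k / 2 ->
    `|x + s *: delta_mx 0 i + t *: delta_mx 0 j - x| < k.
  move=> /andP[s0 sk] /andP[t0 tk].
  have n1 (l : 'I_3) : `|(delta_mx 0 l : 'rV[R]_3)| <= 1.
    rewrite -[leLHS]/(mx_norm _) mx_normrE; apply: bigmax_le => // -[a b] _ /=.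
    by rewrite mxE; case: (_ && _); rewrite ?normr1 ?normr0.
  have -> : x + s *: delta_mx 0 i + t *: delta_mx 0 j - x
      = s *: delta_mx 0 i + t *: delta_mx 0 j by rewrite addrC -addrA addKr.
  rewrite (le_lt_trans (ler_normD _ _))// !normrZ !gtr0_norm//.
  have := ler_wpM2l (ltW s0) (n1 i); have := ler_wpM2l (ltW t0) (n1 j).
  by lra.
have [s [t [sh th E1]]] := second_difference _ _ p q x _ fs h0.
have [t' [s' [th' sh' E2]]] := second_difference _ _ q p x _ fs h0.
have {E1 E2} E : pd q (pd p f) (x + s *: delta_mx 0 p + t *: delta_mx 0 q)
    = pd p (pd q f) (x + t' *: delta_mx 0 q + s' *: delta_mx 0 p).
  apply: (mulIf (lt0r_neq0 h0)); apply: (mulIf (lt0r_neq0 h0)).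
  apply: (etrans (esym E1)); apply: etrans E2.
  by congr (_ + _); rewrite addrAC (addrAC x).
exact: dist_le_of_common (kx _ (near_h q p _ _ th' sh')).1
  (kx _ (near_h p q _ _ sh th)).2 E.
Qed.

(** * The Bochner formula *)

(** Relative to [S] because the Leibniz rule for [pd] asks for differentiable factors: [K] will be
    the ring of all functions and [S] the smooth ones. *)
Definition derivation_on (K : comPzRingType) (S : K -> Prop) (W : K -> K) :=
  [/\ forall u, S u -> S (W u),
      forall u v, S u -> S v -> W (u + v) = W u + W v,
      forall u, S u -> W (- u) = - W u
    & forall u v, S u -> S v -> W (u * v) = W u * v + u * W v].

Definition subring_pred (K : comPzRingType) (S : K -> Prop) :=
  [/\ forall u v, S u -> S v -> S (u + v),
      forall u, S u -> S (- u)
    & forall u v, S u -> S v -> S (u * v)].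

Definition horizontal_laplacian (K : comPzRingType) (A1 A2 : K -> K)
    (V u : K) : K :=
  A1 (A1 u) + A2 (A2 u) - A1 V * A1 u - A2 V * A2 u.

(* The carre du champ identity L(u^2) = 2 u L u + 2 |A u|^2 reduces the
   Bochner formula for W = A1, A2, Z to the commutators [L, W]. *)
Lemma horizontal_laplacian_sqr (K : comPzRingType) (S : K -> Prop)
    (A1 A2 : K -> K) (V u : K) :
  subring_pred K S -> derivation_on K S A1 -> derivation_on K S A2 -> S u ->
  let L := horizontal_laplacian K A1 A2 V in
  L (u * u) = (u * L u + (A1 u * A1 u + A2 u * A2 u)) *+ 2.
Proof.
move=> [SD SN SM] [SA1 A1D A1N A1M] [SA2 A2D A2N A2M] Su L.
rewrite /L /horizontal_laplacian !(A1M, A2M, A1D, A2D); auto.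
by ring.
Qed.

Lemma horizontal_laplacianD (K : comPzRingType) (S : K -> Prop)
    (A1 A2 : K -> K) (V u v : K) :
  derivation_on K S A1 -> derivation_on K S A2 -> S u -> S v ->
  let L := horizontal_laplacian K A1 A2 V in L (u + v) = L u + L v.
Proof.
move=> [SA1 A1D A1N A1M] [SA2 A2D A2N A2M] Su Sv L.
rewrite /L /horizontal_laplacian !(A1D, A2D); auto.
by ring.
Qed.

Lemma martinet_bochner (K : comPzRingType) (S : K -> Prop) (A1 A2 Z : K -> K)
    (Y V f : K) :
  subring_pred K S ->
  derivation_on K S A1 -> derivation_on K S A2 -> derivation_on K S Z ->
  S Y -> A1 Y = 0 -> A2 Y = 1 ->
  (forall u, S u -> A2 (A1 u) = A1 (A2 u) + Y * Z u) ->
  (forall u, S u -> Z (A1 u) = A1 (Z u)) ->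
  (forall u, S u -> Z (A2 u) = A2 (Z u)) ->
  S V -> S f ->
  let L := horizontal_laplacian K A1 A2 V in
  L (A1 f * A1 f + A2 f * A2 f) - (A1 (L f) * A1 f + A2 (L f) * A2 f) *+ 2
  + (L (Z f * Z f) - (Z (L f) * Z f) *+ 2)
  = (A1 (A1 f) * A1 (A1 f) + A2 (A1 f) * A2 (A1 f)
     + A1 (A2 f) * A1 (A2 f) + A2 (A2 f) * A2 (A2 f)
     + A1 (Z f) * A1 (Z f) + A2 (Z f) * A2 (Z f)
     + A1 f * (Y * A2 (Z f) *+ 2 + Z f - A2 V * Y * Z f
               + A1 (A1 V) * A1 f + A1 (A2 V) * A2 f)
     + A2 f * (- (Y * A1 (Z f)) *+ 2 + A1 V * Y * Z f
               + A2 (A1 V) * A1 f + A2 (A2 V) * A2 f)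
     + Z f * (A1 (Z V) * A1 f + A2 (Z V) * A2 f)) *+ 2.
Proof.
move=> SR DA1 DA2 DZ SY A1Y A2Y A2A1 ZA1 ZA2 SV Sf L.
case: (SR) => SD SN SM; case: (DA1) => SA1 A1D A1N A1M.
case: (DA2) => SA2 A2D A2N A2M; case: (DZ) => SZ ZD ZN ZM.
rewrite /L (horizontal_laplacianD K S A1 A2 V _ _ DA1 DA2); [|by auto..].
rewrite !(horizontal_laplacian_sqr K S A1 A2 V _ SR DA1 DA2); [|by auto..].
rewrite /horizontal_laplacian.
rewrite !(A1D, A2D, ZD, A1N, A2N, ZN, A1M, A2M, ZM); [|by auto 12..].
(* The commutators sort every word into the order [A1], [A2], [Z]; a polynomial identity remains. *)
rewrite !(A2A1, ZA1, ZA2, A1D, A2D, A1M, A2M, A1Y, A2Y); [|by auto 12..].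
by ring.
Qed.
(** * The Martinet vector fields *)

(** The one nonconstant entry of [martinet_a], treated as an atom in most computations below. *)
Definition half_sq (R : realType) : 'rV[R]_3 -> R := fun x => x 0 iy ^+ 2 / 2.

Lemma half_sqE (R : realType) :
  half_sq R = coord R iy * coord R iy * (cst 2^-1 : 'rV[R]_3 -> R).
Proof. by apply/funext => x; rewrite /half_sq expr2. Qed.

Lemma smooth_half_sq (R : realType) : smooth (half_sq R).
Proof.
rewrite half_sqE; apply: smoothM; last exact: smooth_cst.
by apply: smoothM; exact: smooth_coord.
Qed.

Lemma inord3_eq (i j : nat) : (i < 3)%N -> (j < 3)%N ->
  (@inord 2 i == @inord 2 j) = (i == j).
Proof. by move=> i3 j3; rewrite -val_eqE /= !inordK. Qed.

Lemma pd_half_sq (R : realType) (p : 'I_3) :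
  pd p (half_sq R) = if p == iy then coord R iy else 0.
Proof.
have sY := smooth_coord R iy; have sc := smooth_cst R 2^-1.
rewrite half_sqE (pdM _ (coord R iy * coord R iy) _ p (smoothM _ _ _ sY sY) sc).
rewrite (pdM _ _ _ p sY sY) pd_coord pd_cst.
case: (p == iy); apply/funext => x /=; rewrite !fctE /=; first by field.
by rewrite !(mul0r, mulr0, addr0).
Qed.

Lemma smooth_subring (R : realType) : subring_pred ('rV[R]_3 -> R) (@smooth R).
Proof. by split; [exact: smoothD|exact: smoothN|exact: smoothM]. Qed.

Lemma pd_derivation (R : realType) (p : 'I_3) :
  derivation_on ('rV[R]_3 -> R) (@smooth R) (pd p).
Proof.
by split=> *; [exact: smooth_pd|exact: pdD|exact: pdN|exact: pdM].
Qed.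

Lemma derivation_on_comb (K : comPzRingType) (S : K -> Prop)
    (W1 W2 : K -> K) (c : K) :
  subring_pred K S -> S c -> derivation_on K S W1 -> derivation_on K S W2 ->
  derivation_on K S (fun u => W1 u + c * W2 u).
Proof.
move=> [SD SN SM] Sc [S1 D1 N1 M1] [S2 D2 N2 M2]; split.
- by move=> u Su; apply: SD; auto.
- by move=> u v Su Sv; rewrite D1 ?D2//; ring.
- by move=> u Su; rewrite N1 ?N2//; ring.
- by move=> u v Su Sv; rewrite M1 ?M2//; ring.
Qed.

Lemma martinet_A1_derivation (R : realType) :
  derivation_on ('rV[R]_3 -> R) (@smooth R) (@martinet_A1 R).
Proof.
apply: (derivation_on_comb _ _ (pd ix) (pd iz) (half_sq R)).
- exact: smooth_subring.
- exact: smooth_half_sq.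
- exact: pd_derivation.
- exact: pd_derivation.
Qed.

Lemma martinet_A1E (R : realType) (f : 'rV[R]_3 -> R) :
  martinet_A1 f = pd ix f + half_sq R * pd iz f.
Proof. by []. Qed.

Lemma pd_martinet_A1 (R : realType) (f : 'rV[R]_3 -> R) (p : 'I_3) : smooth f ->
  pd p (martinet_A1 f)
  = pd p (pd ix f) + (pd p (half_sq R) * pd iz f + half_sq R * pd p (pd iz f)).
Proof.
move=> fs; have fxs := smooth_pd _ _ ix fs; have fzs := smooth_pd _ _ iz fs.
have ws := smooth_half_sq R.
rewrite -(pdM _ (half_sq R) (pd iz f) p ws fzs).
exact: pdD _ (pd ix f) (half_sq R * pd iz f) p fxs (smoothM _ _ _ ws fzs).
Qed.

(** The bracket is the derivative along y of the coefficient [half_sq]; the second-order terms match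
    by [pdC]. *)
Lemma martinet_comm21 (R : realType) (f : 'rV[R]_3 -> R) : smooth f ->
  martinet_A2 (martinet_A1 f)
  = martinet_A1 (martinet_A2 f) + coord R iy * martinet_Z f.
Proof.
move=> fs; rewrite [LHS](pd_martinet_A1 _ _ iy fs) pd_half_sq eqxx.
rewrite (pdC _ _ iy ix fs) (pdC _ _ iy iz fs) [X in _ + X]addrC addrA.
by [].
Qed.

Lemma martinet_commZ1 (R : realType) (f : 'rV[R]_3 -> R) : smooth f ->
  martinet_Z (martinet_A1 f) = martinet_A1 (martinet_Z f).
Proof.
move=> fs; rewrite [LHS](pd_martinet_A1 _ _ iz fs) pd_half_sq inord3_eq//.
by rewrite mul0r add0r (pdC _ _ iz ix fs).
Qed.

Lemma martinet_commZ2 (R : realType) (f : 'rV[R]_3 -> R) : smooth f ->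
  martinet_Z (martinet_A2 f) = martinet_A2 (martinet_Z f).
Proof. by move=> fs; exact: pdC. Qed.

(** * Entries of the Martinet matrices, and the generator *)

Notation i0 := (@inord 1 0) (only parsing).
Notation i1 := (@inord 1 1) (only parsing).

Lemma sum2 (V : nmodType) (F : 'I_2 -> V) : \sum_(i < 2) F i = F i0 + F i1.
Proof.
by rewrite !big_ord_recl big_ord0 addr0; congr (F _ + F _); apply: val_inj;
  rewrite /= inordK.
Qed.

Lemma sum3 (V : nmodType) (F : 'I_3 -> V) :
  \sum_(p < 3) F p = F ix + F iy + F iz.
Proof.
rewrite !big_ord_recl big_ord0 addr0 addrA.
by congr (F _ + F _ + F _); apply: val_inj; rewrite /= inordK.
Qed.

Lemma dotE (R : realType) n (u v : 'cV[R]_n) : dot u v = \sum_p u p 0 * v p 0.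
Proof. by rewrite /dot mxE; apply: eq_bigr => p _; rewrite mxE. Qed.

Lemma fAE (R : realType) (a : 'rV[R]_3 -> 'M[R]_(3, 2)) i (f : 'rV[R]_3 -> R) x :
  fA a i f x = \sum_p al a i p x * pd p f x.
Proof. by rewrite /fA mxE; apply: eq_bigr => p _; rewrite [grad _ _ _ _]mxE. Qed.

Lemma mul_aaT_grad (R : realType) (a : 'rV[R]_3 -> 'M[R]_(3, 2))
    (f : 'rV[R]_3 -> R) x p :
  (a x *m (a x)^T *m grad f x) p 0 = \sum_i al a i p x * fA a i f x.
Proof. by rewrite -mulmxA mxE; apply: eq_bigr => i _; rewrite /al [_^T i p]mxE. Qed.

(** A product of equations rather than a conjunction, so that it serves as a single multirule for
    [rewrite]. *)
Lemma martinet_alE (R : realType) :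
  (al (@martinet_a R) i0 ix = cst 1) * (al (@martinet_a R) i0 iy = cst 0)
  * (al (@martinet_a R) i0 iz = half_sq R) * (al (@martinet_a R) i1 ix = cst 0)
  * (al (@martinet_a R) i1 iy = cst 1) * (al (@martinet_a R) i1 iz = cst 0).
Proof.
by do !split; apply/funext => x; rewrite /al /martinet_a trmxK mxE !inordK.
Qed.

Lemma martinet_zeE (R : realType) :
  (ze (@martinet_z R) ix = cst 0) * (ze (@martinet_z R) iy = cst 0)
  * (ze (@martinet_z R) iz = cst 1).
Proof. by do !split; apply/funext => x; rewrite /ze /martinet_z trmxK mxE !inordK. Qed.

Lemma pd_ix_half_sq (R : realType) : pd ix (half_sq R) = cst 0.
Proof. by rewrite pd_half_sq inord3_eq. Qed.
Lemma pd_iy_half_sq (R : realType) : pd iy (half_sq R) = coord R iy.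
Proof. by rewrite pd_half_sq eqxx. Qed.
Lemma pd_iz_half_sq (R : realType) : pd iz (half_sq R) = cst 0.
Proof. by rewrite pd_half_sq inord3_eq. Qed.

Definition martinet_pdE (R : realType) := (pd_ix_half_sq R, pd_iy_half_sq R,
  pd_iz_half_sq R, pd_cst R).

Lemma martinet_fA1 (R : realType) (f : 'rV[R]_3 -> R) :
  fA (@martinet_a R) i0 f = martinet_A1 f.
Proof.
apply/funext => x; rewrite fAE sum3 !martinet_alE martinet_A1E !fctE /=.
by move: (pd _ _ _) (pd _ _ _) (pd _ _ _) => *; ring.
Qed.

Lemma martinet_fA2 (R : realType) (f : 'rV[R]_3 -> R) :
  fA (@martinet_a R) i1 f = martinet_A2 f.
Proof.
apply/funext => x; rewrite fAE sum3 !martinet_alE /martinet_A2 /=.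
by move: (pd _ _ _) (pd _ _ _) (pd _ _ _) => *; ring.
Qed.

Lemma martinet_fZ (R : realType) (f : 'rV[R]_3 -> R) :
  fZ (@martinet_z R) f = martinet_Z f.
Proof.
apply/funext => x; rewrite /fZ mxE sum3 ![grad _ _ _ _]mxE.
have E p : (martinet_z x)^T 0 p = ze (@martinet_z R) p x by [].
rewrite !E !martinet_zeE /martinet_Z /=.
by move: (pd _ _ _) (pd _ _ _) (pd _ _ _) => *; ring.
Qed.

(** Both fields are divergence free: the only nonconstant coefficient belongs to [pd iz] and depends
    on y alone. *)
Lemma martinet_atensor (R : realType) x : atensor (@martinet_a R) x = 0.
Proof.
apply/colP => p; rewrite !mxE sum2 !sum3 !martinet_alE !martinet_pdE /=.
by rewrite !mulr0 !addr0.
Qed.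

(** With w for [half_sq], the flux has components A1 f, A2 f and w A1 f. As w does not depend on z,
    its divergence is A1 A1 f + A2 A2 f. *)
Lemma martinet_generatorE (R : realType) (V f : 'rV[R]_3 -> R) : smooth f ->
  generator (@martinet_a R) V f
  = horizontal_laplacian ('rV[R]_3 -> R) (@martinet_A1 R) (@martinet_A2 R) V f.
Proof.
move=> fs; have [SA1 _ _ _] := martinet_A1_derivation R.
have s1 := SA1 _ fs; have s2 : smooth (martinet_A2 f) := smooth_pd _ _ iy fs.
pose F p w := (martinet_a w *m (martinet_a w)^T *m grad f w) p 0.
have FE p w : F p w = al (@martinet_a R) i0 p w * martinet_A1 f w
                      + al (@martinet_a R) i1 p w * martinet_A2 f w.
  by rewrite /F mul_aaT_grad sum2 martinet_fA1 martinet_fA2.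
have Fx : F ix = martinet_A1 f.
  by apply/funext => w; rewrite FE !martinet_alE /= mul1r mul0r addr0.
have Fy : F iy = martinet_A2 f.
  by apply/funext => w; rewrite FE !martinet_alE /= mul1r mul0r add0r.
have Fz : F iz = half_sq R * martinet_A1 f.
  by apply/funext => w; rewrite FE !martinet_alE /= mul0r addr0.
apply/funext => x; rewrite /generator martinet_atensor !dotE /div !sum3.
rewrite -![fun w => _]/(F _) -![(_ *m grad f x) _ 0]/(F _ x) Fx Fy Fz.
rewrite (pdM _ _ _ iz (smooth_half_sq R) s1) pd_iz_half_sq.
rewrite ![grad _ _ _ _]mxE ![(0 : 'cV_3) _ _]mxE.
rewrite /horizontal_laplacian (martinet_A1E _ (martinet_A1 f)).
rewrite (martinet_A1E _ V) !fctE /=.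
rewrite -![martinet_A2 _ x]/(pd iy _ x).
move: (pd ix (martinet_A1 f) x) (pd iz (martinet_A1 f) x) => d1 d2.
move: (pd iy (martinet_A2 f) x) (pd ix V x) (pd iy V x) => d3 v1 v2.
move: (pd iz V x) (pd ix f x) (pd iy f x) (pd iz f x) => v3 f1 f2 f3.
move: (half_sq R x) (martinet_A1 f x) => w u.
by ring.
Qed.
(** * The left-hand side *)

(** Every difference quotient vanishes. This disposes of entries constant along an axis without
    computing them. *)
Lemma pd_invariant (R : realType) (g : 'rV[R]_3 -> R) (p : 'I_3) :
  (forall h w, g (h *: delta_mx 0 p + w) = g w) -> pd p g = cst 0.
Proof.
move=> gp; apply/funext => x; apply: cvg_lim => //; apply: cvg_near_cst.
by apply: nearW => h; rewrite /= gp subrr scaler0.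
Qed.

Lemma martinet_a_invariant (R : realType) h (w : 'rV[R]_3) :
  martinet_a (h *: delta_mx 0 iz + w) = martinet_a w.
Proof.
by rewrite /martinet_a !mxE inord3_eq//= mulr0 add0r.
Qed.

Lemma div_eq0 (R : realType) (F : 'rV[R]_3 -> 'cV[R]_3) x :
  (forall w, F w = 0) -> div F x = 0.
Proof.
move=> F0; apply: big1 => p _.
have -> : (fun w => F w p 0) = cst 0 by apply/funext => w; rewrite F0 mxE.
by rewrite pd_cst.
Qed.

Lemma dquad_eq0 (R : realType) (M : 'rV[R]_3 -> 'M[R]_3) f x p :
  dmx p M x = 0 -> dquad M f x p 0 = 0.
Proof. by move=> M0; rewrite mxE M0 mul0mx /dot mulmx0 mxE. Qed.

Lemma martinet_dmx_aaT (R : realType) x :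
  dmx iz (fun w => martinet_a w *m (@martinet_a R w)^T) x = 0.
Proof.
apply/matrixP => i j; rewrite !mxE pd_invariant// => h w.
by rewrite martinet_a_invariant.
Qed.

Lemma martinet_dmx_zzT (R : realType) p x :
  dmx p (fun w => martinet_z w *m (@martinet_z R w)^T) x = 0.
Proof. by apply/matrixP => i j; rewrite !mxE pd_invariant. Qed.

(** Both divergences are of fields that vanish identically: the transpose of [z] selects the
    z-component, where the derivative of [a a^T] is zero, and [z z^T] is constant. *)
Lemma martinet_Gamma2zE (R : realType) (V rho f : 'rV[R]_3 -> R) x :
  let a := @martinet_a R in let z := @martinet_z R in
  Gamma2z a z V rho f x = 2^-1 * (generator a V (Gamma1z z f f) x
                                  - 2 * Gamma1z z (generator a V f) f x).
Proof.
move=> a z; rewrite /Gamma2z.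
rewrite [X in _ + _ * X - _]div_eq0 => [|w].
  rewrite [X in _ - _ * X]div_eq0 => [|w]; first by rewrite !mulr0 addr0 subr0.
  have -> : dquad (fun w => z w *m (z w)^T) f w = 0.
    by apply/colP => p; rewrite dquad_eq0 ?martinet_dmx_zzT// [RHS]mxE.
  by rewrite mulmx0 scaler0.
rewrite -mulmxA.
have -> : (z w)^T *m dquad (fun w => a w *m (a w)^T) f w = 0.
  apply/matrixP => i j; rewrite !ord1 [LHS]mxE [RHS]mxE sum3.
  rewrite -![(z w)^T _ _]/(ze z _ w) !martinet_zeE /=.
  rewrite [dquad _ _ _ iz 0]dquad_eq0 ?martinet_dmx_aaT//.
  by move: (dquad _ _ _ _ _) (dquad _ _ _ _ _) => *; ring.
by rewrite mulmx0 scaler0.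
Qed.

(** This is [martinet_bochner] in the ring of functions, evaluated at [x] and halved. *)
Lemma martinet_Gamma_sum (R : realType) (V rho f : 'rV[R]_3 -> R) (x : 'rV[R]_3) :
  let a := @martinet_a R in let z := @martinet_z R in
  let A1 := @martinet_A1 R in let A2 := @martinet_A2 R in
  let Z := @martinet_Z R in let y := x 0 iy in
  smooth V -> smooth f ->
  Gamma2 a V f x + Gamma2z a z V rho f x
  = A1 (A1 f) x ^+ 2 + A2 (A1 f) x ^+ 2 + A1 (A2 f) x ^+ 2 + A2 (A2 f) x ^+ 2
    + A1 (Z f) x ^+ 2 + A2 (Z f) x ^+ 2
    + A1 f x * (2 * y * A2 (Z f) x + Z f x - y * A2 V x * Z f x
                + A1 (A1 V) x * A1 f x + A1 (A2 V) x * A2 f x)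
    + A2 f x * (- (2 * y * A1 (Z f) x) + y * A1 V x * Z f x
                + A2 (A1 V) x * A1 f x + A2 (A2 V) x * A2 f x)
    + Z f x * (A1 (Z V) x * A1 f x + A2 (Z V) x * A2 f x).
Proof.
move=> a z A1 A2 Z y Vs fs; rewrite martinet_Gamma2zE /Gamma2.
pose L := horizontal_laplacian ('rV[R]_3 -> R) A1 A2 V.
have Y1 : A1 (coord R iy) = 0.
  rewrite /A1 martinet_A1E !pd_coord !inord3_eq//=.
  by apply/funext => w; rewrite !fctE /= mulr0 addr0.
have Y2 : A2 (coord R iy) = 1.
  by rewrite [LHS]pd_coord eqxx.
have DA1 := martinet_A1_derivation R.
have DA2 : derivation_on _ (@smooth R) A2 := pd_derivation R iy.
have DZ : derivation_on _ (@smooth R) Z := pd_derivation R iz.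
have G1 g : Gamma1 a g f = A1 g * A1 f + A2 g * A2 f.
  by apply/funext => w; rewrite /Gamma1 sum2 !martinet_fA1 !martinet_fA2.
have GZ g : Gamma1z z g f = Z g * Z f.
  by apply/funext => w; rewrite /Gamma1z !martinet_fZ.
have [[SA1 _ _ _] [SA2 _ _ _] [SZ _ _ _]] := And3 DA1 DA2 DZ.
have sG1 : smooth (A1 f * A1 f + A2 f * A2 f).
  by apply: smoothD; apply: smoothM; [exact: SA1|exact: SA1|exact: SA2|exact: SA2].
have sGZ : smooth (Z f * Z f) by apply: smoothM; exact: SZ.
rewrite !G1 !GZ !martinet_generatorE// -/L.
have := martinet_bochner _ (@smooth R) A1 A2 Z (coord R iy) V f (smooth_subring R)
  DA1 DA2 DZ (smooth_coord R iy) Y1 Y2 (martinet_comm21 R) (martinet_commZ1 R)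
  (martinet_commZ2 R) Vs fs.
rewrite -/L => /(congr1 (fun g => g x)).
rewrite -[y]/(coord R iy x) => H; clear -H; clearbody L A1 A2 Z; move: H.
rewrite !mulr2n !fctE /= => H.
have two0 : 2 != 0 :> R by rewrite pnatr_eq0.
apply: (mulfI two0); apply: etrans (etrans H _); first by field.
by ring.
Qed.

(** * Vanishing of [Z] on the entries of [a] and on their derivatives *)

Lemma pd_pd_invariant (R : realType) (g : 'rV[R]_3 -> R) (p q : 'I_3) :
  (forall h w, g (h *: delta_mx 0 p + w) = g w) -> pd p (pd q g) = cst 0.
Proof.
move=> gp; apply: pd_invariant => h w.
(* The difference quotients of [g] inherit its invariance, hence so does [pd q g]. *)
have E : (fun k : R => k^-1 *: ((g \o shift (h *: delta_mx 0 p + w))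
              (k *: delta_mx 0 q) - g (h *: delta_mx 0 p + w)))
    = (fun k => k^-1 *: ((g \o shift w) (k *: delta_mx 0 q) - g w)).
  by apply/funext => k; rewrite /= [k *: _ + _]addrCA !gp.
by rewrite /pd /derive E.
Qed.

Lemma martinet_al_invariant (R : realType) i p h (w : 'rV[R]_3) :
  al (@martinet_a R) i p (h *: delta_mx 0 iz + w) = al (@martinet_a R) i p w.
Proof. by rewrite /al martinet_a_invariant. Qed.

Lemma martinet_pd_ze (R : realType) p q :
  pd p (ze (@martinet_z R) q) = cst 0.
Proof. exact: pd_invariant. Qed.

Lemma martinet_ze_val (R : realType) p (x : 'rV[R]_3) :
  p != iz -> ze (@martinet_z R) p x = 0.
Proof.
move=> pz; rewrite /ze /martinet_z trmxK mxE.
case: p pz => -[|[|[|//]]] p3 //=; rewrite -val_eqE /= inordK//.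
Qed.

(** Either [p] is not the z-index and the coefficient of [Z] is zero, or the entry of [a] is
    independent of z. *)
Lemma martinet_ze_pd_al (R : realType) i p q (x : 'rV[R]_3) :
  ze (@martinet_z R) p x * pd p (al (@martinet_a R) i q) x = 0.
Proof.
have [->|pz] := eqVneq p iz; last by rewrite martinet_ze_val// mul0r.
by rewrite pd_invariant ?mulr0// => h w; exact: martinet_al_invariant.
Qed.

Lemma martinet_ze_pd_pd_al (R : realType) i p q r (x : 'rV[R]_3) :
  ze (@martinet_z R) p x * pd p (pd q (al (@martinet_a R) i r)) x = 0.
Proof.
have [->|pz] := eqVneq p iz; last by rewrite martinet_ze_val// mul0r.
by rewrite pd_pd_invariant ?mulr0// => h w; exact: martinet_al_invariant.
Qed.

(** * The right-hand side *)

Lemma sum4 (V : nmodType) (F : 'I_4 -> V) :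
  \sum_(u < 4) F u
  = F (@inord 3 0) + F (@inord 3 1) + F (@inord 3 2) + F (@inord 3 3).
Proof.
rewrite !big_ord_recl big_ord0 addr0 !addrA.
by do !congr (_ + _); congr (F _); apply: val_inj; rewrite /= inordK.
Qed.

Lemma sum9 (V : nmodType) (F : 'I_9 -> V) :
  \sum_(u < 9) F u
  = F (@inord 8 0) + F (@inord 8 1) + F (@inord 8 2) + F (@inord 8 3)
    + F (@inord 8 4) + F (@inord 8 5) + F (@inord 8 6) + F (@inord 8 7)
    + F (@inord 8 8).
Proof.
rewrite !big_ord_recl big_ord0 addr0 !addrA.
by do !congr (_ + _); congr (F _); apply: val_inj; rewrite /= inordK.
Qed.

Lemma fst3E k : (k < 9)%N -> fst3 (inord k) = inord (k %/ 3).
Proof. by move=> k9; rewrite /fst3 inordK. Qed.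

Lemma snd3E k : (k < 9)%N -> snd3 (inord k) = inord (k %% 3).
Proof. by move=> k9; rewrite /snd3 inordK. Qed.

Lemma fst2E k : (k < 4)%N -> fst2 (inord k) = inord (k %/ 2).
Proof. by move=> k4; rewrite /fst2 inordK. Qed.

Lemma snd2E k : (k < 4)%N -> snd2 (inord k) = inord (k %% 2).
Proof. by move=> k4; rewrite /snd2 inordK. Qed.

Lemma quad_dot (R : realType) m n (M : 'M[R]_(m, n)) (v : 'cV[R]_n) :
  (v^T *m M^T *m M *m v) 0 0 = dot (M *m v) (M *m v).
Proof. by rewrite /dot trmx_mul !mulmxA. Qed.

(** The rows of [Q] are the principal symbols of A1 A1, A1 A2, A2 A1 and A2 A2, and the squares
    appear in this order. *)
Lemma martinet_QE (R : realType) (x : 'rV[R]_3) (v : 'cV[R]_9) :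
  let Q := Qmx (@martinet_a R) x in let w := half_sq R x in
  let c k := v (@inord 8 k) 0 in
  (v^T *m Q^T *m Q *m v) 0 0
  = (c 0%N + w * c 2%N + w * c 6%N + w ^+ 2 * c 8%N) ^+ 2 + (c 1%N + w * c 7%N) ^+ 2
    + (c 3%N + w * c 5%N) ^+ 2 + c 4%N ^+ 2.
Proof.
move=> Q w c; rewrite quad_dot dotE sum4 !mxE !sum9.
rewrite ![Q _ _]mxE !fst3E// !snd3E// !fst2E// !snd2E//.
rewrite !martinet_alE /= -/w -!/(c _).
by ring.
Qed.

(** The rows of [P] are the principal symbols of Z A1 and Z A2. *)
Lemma martinet_PE (R : realType) (x : 'rV[R]_3) (v : 'cV[R]_9) :
  let P := Pmx (@martinet_a R) (@martinet_z R) x in let w := half_sq R x in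
  let c k := v (@inord 8 k) 0 in
  (v^T *m P^T *m P *m v) 0 0 = (c 6%N + w * c 8%N) ^+ 2 + c 7%N ^+ 2.
Proof.
move=> P w c; rewrite quad_dot dotE sum2 !mxE !sum9.
rewrite ![P _ _]mxE !fst3E// !snd3E//.
rewrite !martinet_alE !martinet_zeE /= -/w -!/(c _).
by ring.
Qed.

Lemma pd_scale (R : realType) (c : R) (f : 'rV[R]_3 -> R) (p : 'I_3) x :
  smooth f -> pd p ((cst c : 'rV[R]_3 -> R) * f) x = c * pd p f x.
Proof.
move=> fs; rewrite (pdM _ _ _ p (smooth_cst R c) fs) pd_cst !fctE /=.
by move: (pd p f x) => d; ring.
Qed.

Lemma martinet_driftE (R : realType) (V : 'rV[R]_3 -> R) :
  let b := drift (@martinet_a R) V in let h : 'rV[R]_3 -> R := cst (- 2^-1) in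
  (b ix = h * martinet_A1 V) * (b iy = h * martinet_A2 V)
  * (b iz = h * (half_sq R * martinet_A1 V)).
Proof.
by move=> b h; do !split; apply/funext => x;
  rewrite /b /drift [LHS]mxE mul_aaT_grad sum2 martinet_fA1 martinet_fA2
    !martinet_alE !fctE /=;
  move: (martinet_A1 V x) (martinet_A2 V x) (half_sq R x) => *; rewrite /h /=; ring.
Qed.

Lemma pd_martinet_drift (R : realType) (V : 'rV[R]_3 -> R) (p : 'I_3) x :
  smooth V ->
  let b := drift (@martinet_a R) V in
  let A1V := pd ix V x + half_sq R x * pd iz V x in
  let dA1V := pd p (pd ix V) x
    + (pd p (half_sq R) x * pd iz V x + half_sq R x * pd p (pd iz V) x) in
  (pd p (b ix) x = - 2^-1 * dA1V)
  * (pd p (b iy) x = - 2^-1 * pd p (pd iy V) x)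
  * (pd p (b iz) x
     = - 2^-1 * (pd p (half_sq R) x * A1V + half_sq R x * dA1V)).
Proof.
move=> Vs b A1V dA1V; have [SA1 _ _ _] := martinet_A1_derivation R.
have [s1 s2 sw] := And3 (SA1 _ Vs) (smooth_pd _ _ iy Vs) (smooth_half_sq R).
rewrite /b !martinet_driftE.
rewrite (pd_scale _ _ _ p x s1) (pd_scale _ _ _ p x s2).
rewrite (pd_scale _ _ _ p x (smoothM _ _ _ sw s1)).
by rewrite (pdM _ _ _ p sw s1) (pd_martinet_A1 _ _ p Vs).
Qed.

Lemma martinet_driftE_at (R : realType) (V : 'rV[R]_3 -> R) x :
  let b := drift (@martinet_a R) V in
  let A1V := pd ix V x + half_sq R x * pd iz V x in
  (b ix x = - 2^-1 * A1V) * (b iy x = - 2^-1 * pd iy V x)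
  * (b iz x = - 2^-1 * (half_sq R x * A1V)).
Proof. by move=> b A1V; rewrite /b !martinet_driftE. Qed.

Lemma sum33 (V : nmodType) (F : 'I_3 -> 'I_3 -> V) :
  \sum_(p < 3) \sum_(q < 3) F p q
  = F ix ix + F ix iy + F ix iz + (F iy ix + F iy iy + F iy iz)
    + (F iz ix + F iz iy + F iz iz).
Proof. by rewrite !sum3. Qed.

(** Only A2 acts nontrivially on a coefficient, that of A1, so [D] has a single nonzero entry, in
    row (2,1). *)
Lemma martinet_Dsqr (R : realType) (f : 'rV[R]_3 -> R) (x : 'rV[R]_3) :
  let D := Dvec (@martinet_a R) f x in
  dot D D = (x 0 iy * pd iz f x) ^+ 2.
Proof.
move=> D; rewrite dotE; under eq_bigr => u _ do rewrite [D u 0]mxE sum33.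
rewrite sum4 !fst2E// !snd2E// !martinet_alE !martinet_pdE /=.
rewrite -[x 0 iy]/(coord R iy x).
move: (pd ix f x) (pd iy f x) (pd iz f x) (coord R iy x) (half_sq R x) => *.
by ring.
Qed.

Lemma martinet_Esqr (R : realType) (f : 'rV[R]_3 -> R) (x : 'rV[R]_3) :
  let E := Evec (@martinet_a R) (@martinet_z R) f x in dot E E = 0.
Proof.
move=> E; rewrite dotE; under eq_bigr => u _ do rewrite [E u 0]mxE sum33.
rewrite sum2 !martinet_alE !martinet_zeE !martinet_pdE /=.
move: (pd ix f x) (pd iy f x) (pd iz f x) (half_sq R x) => *.
by ring.
Qed.

(** * The tensors [Rzb] and [Rrho] *)

Lemma martinet_RzbE (R : realType) (V f : 'rV[R]_3 -> R) (x : 'rV[R]_3) :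
  smooth V ->
  Rzb (@martinet_a R) (@martinet_z R) V f x
  = (pd ix (pd iz V) x + half_sq R x * pd iz (pd iz V) x)
      * (pd ix f x + half_sq R x * pd iz f x) * pd iz f x
    + pd iy (pd iz V) x * pd iy f x * pd iz f x.
Proof.
move=> Vs; rewrite /Rzb sum33 martinet_fZ /martinet_Z.
(* Outside the drift, every summand differentiates the constant [z] or applies [Z] to an entry of
   [a] or to its derivative. *)
rewrite big1 => [|i _].
  rewrite !martinet_zeE !martinet_pdE !pd_martinet_drift//.
  rewrite !martinet_driftE_at !martinet_pdE /=.
  move: (pdC _ _ iz ix Vs) (pdC _ _ iz iy Vs) (half_sq R x).
  by move: (@pd R) ix iy iz => d jx jy jz -> -> w; field.
apply: big1 => p _; apply: big1 => q _; apply: big1 => r _.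
rewrite !martinet_pd_ze pd_cst.
rewrite [ze _ r x * _ * pd r (pd p _) x]mulrAC.
rewrite martinet_ze_pd_al martinet_ze_pd_pd_al /=.
move: (pd p _ x) (pd r f x) (pd q f x) (pd iz f x) => *.
by ring.
Qed.

(** In the first two sums each summand differentiates [z] or contains [Z] applied to an entry of [a]
    or to its derivative; in the last two each contains a derivative of [z]. *)
Lemma martinet_RrhoE (R : realType) (rho f : 'rV[R]_3 -> R) (x : 'rV[R]_3) :
  Rrho (@martinet_a R) (@martinet_z R) rho f x = 0.
Proof.
rewrite /Rrho.
rewrite [X in 2 * X + _ - _ - _]big1 => [|i _]; last first.
  apply: big1 => p _; apply: big1 => q _.
  apply: big1 => r _; apply: big1 => s _.
  rewrite !martinet_pd_ze [ze _ p x * _ * pd p (pd q _) x]mulrAC.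
  rewrite martinet_ze_pd_pd_al -[ze _ p x * ze _ q x * pd q _ x]mulrA.
  rewrite martinet_ze_pd_al /=.
  move: (pd q _ x) (pd p _ x) (pd r f x) (pd s f x) (ze _ q x) (ze _ p x).
  by move=> *; ring.
rewrite [X in _ + 2 * X - _ - _]big1 => [|i _]; last first.
  apply: big1 => q _; apply: big1 => r _; apply: big1 => s _.
  rewrite -[_ * ze _ q x * pd q _ x]mulrA martinet_ze_pd_al.
  by move: (fZ _ _ x) (pd r f x) (pd s f x) => *; ring.
rewrite [X in _ - 2 * X - _]big1 => [|i _]; last first.
  apply: big1 => p _; apply: big1 => q _.
  apply: big1 => r _; apply: big1 => s _.
  rewrite !martinet_pd_ze !pd_cst /=.
  by move: (pd p _ x) (pd p _ x) (pd r f x) (pd s f x) => *; ring.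
rewrite [X in _ - _ - 2 * X]big1 ?mulr0 ?subr0 ?addr0// => i _.
apply: big1 => q _; apply: big1 => r _; apply: big1 => s _.
rewrite !martinet_pd_ze /=.
by move: (fA _ _ _ x) (pd r f x) (pd s f x) => *; ring.
Qed.

(** * The tensors [Rab] and [RabG] *)

Lemma ord2_cases (i : 'I_2) : i = i0 \/ i = i1.
Proof.
by case: i => -[|[|//]] i2; [left|right]; apply: val_inj; rewrite /= inordK.
Qed.

Lemma ord3_cases (p : 'I_3) : [\/ p = ix, p = iy | p = iz].
Proof.
by case: p => -[|[|[|//]]] p3; [apply: Or31|apply: Or32|apply: Or33];
  apply: val_inj; rewrite /= inordK.
Qed.

Lemma inord2_eq (i j : nat) : (i < 2)%N -> (j < 2)%N ->
  (@inord 1 i == @inord 1 j) = (i == j).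
Proof. by move=> i2 j2; rewrite -val_eqE /= !inordK. Qed.

(** One boolean formula for all indices lets the fivefold sum of [Rab] collapse by cases instead of
    being unrolled into 108 terms. *)
Lemma martinet_pd_al (R : realType) k q r :
  pd q (al (@martinet_a R) k r)
  = if [&& q == iy, k == i0 & r == iz] then coord R iy else cst 0.
Proof.
have [->|->] := ord2_cases k; have [->|->|->] := ord3_cases r;
  rewrite !martinet_alE ?pd_cst ?pd_half_sq ?inord2_eq ?inord3_eq//= ?andbF//.
by rewrite andbT.
Qed.

Lemma martinet_pd_pd_al (R : realType) k p q r :
  pd p (pd q (al (@martinet_a R) k r))
  = cst [&& p == iy, q == iy, k == i0 & r == iz]%:R.
Proof.
rewrite martinet_pd_al; case: ifP => _; last by rewrite pd_cst andbF.
by rewrite pd_coord andbT.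
Qed.

Lemma martinet_al_i0_iy (R : realType) (x : 'rV[R]_3) :
  al (@martinet_a R) i0 iy x = 0.
Proof. by rewrite !martinet_alE. Qed.

(** Of the four families only the one with a second derivative of [al a k r] survives, at p = q = y,
    k = 1, r = z; there the factor [al a i iy] squared retains i = 2 alone. *)
Lemma martinet_Rab_quadratic (R : realType) (g : 'I_3 -> R) (h : 'I_2 -> R)
    (x : 'rV[R]_3) :
  let a := @martinet_a R in
  \sum_(i < 2) \sum_(k < 2) \sum_(p < 3) \sum_(q < 3) \sum_(r < 3)
    ((  al a i p x * pd p (al a i q) x * pd q (al a k r) x * g r
      + al a i p x * al a i q x * pd p (pd q (al a k r)) x * g r
      - al a k r x * pd r (al a i p) x * pd p (al a i q) x * g q
      - al a k r x * al a i p x * pd r (pd p (al a i q)) x * g q)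
     * h k) = g iz * h i0.
Proof.
move=> a.
pose u i p := al a i p x.
pose K p q k r : R := [&& p == iy, q == iy, k == i0 & r == iz]%:R.
transitivity (\sum_(i < 2) \sum_(k < 2) \sum_(p < 3) \sum_(q < 3) \sum_(r < 3)
    (u i p * u i q * K p q k r * g r * h k)).
  apply: eq_bigr => i _; apply: eq_bigr => k _; apply: eq_bigr => p _.
  apply: eq_bigr => q _; apply: eq_bigr => r _; congr (_ * h k).
  (* A nonzero derivative needs p = y and i = 1, but A1 has no y-component. *)
  have -> : al a i p x * pd p (al a i q) x = 0.
    rewrite martinet_pd_al; case: ifP => [/and3P[/eqP-> /eqP-> _]|_].
      by rewrite martinet_al_i0_iy mul0r.
    by rewrite mulr0.
  (* The first derivative needs p = z, the second p = y. *)
  have -> : al a k r x * pd r (al a i p) x * pd p (al a i q) x = 0.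
    rewrite !martinet_pd_al -mulrA; case: ifP => [/and3P[_ _ /eqP->]|_].
      by rewrite inord3_eq//= !mulr0.
    by rewrite mul0r mulr0.
  have -> : al a k r x * al a i p x * pd r (pd p (al a i q)) x = 0.
    rewrite martinet_pd_pd_al -mulrA.
    case: (boolP [&& _, _, _ & _]) => [/and4P[_ /eqP-> /eqP-> _]|_] /=.
      by rewrite martinet_al_i0_iy mul0r mulr0.
    by rewrite !mulr0.
  rewrite martinet_pd_pd_al /cst -/(K p q k r) -!/(u _ _).
  by move: (u i p) (u i q) (K p q k r) => *; ring.
have ui0 : u i0 iy = 0 by exact: martinet_al_i0_iy.
have ui1 : u i1 iy = 1 by rewrite /u !martinet_alE.
clearbody u.
(* The Kronecker factor [K] leaves one index in each of the three sums. *)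
have KE i k : \sum_(p < 3) \sum_(q < 3) \sum_(r < 3)
    (u i p * u i q * K p q k r * g r * h k)
  = u i iy * u i iy * K iy iy k iz * g iz * h k.
  rewrite (bigD1 iy)//= [X in _ + X]big1 ?addr0 => [|p py]; last first.
    apply: big1 => q _; apply: big1 => r _.
    by rewrite /K (negbTE py) /= !(mulr0, mul0r).
  rewrite (bigD1 iy)//= [X in _ + X]big1 ?addr0 => [|q qy]; last first.
    by apply: big1 => r _; rewrite /K (negbTE qy) /= andbF !(mulr0, mul0r).
  rewrite (bigD1 iz)//= [X in _ + X]big1 ?addr0// => r rz.
  by rewrite /K (negbTE rz) !andbF !(mulr0, mul0r).
rewrite !sum2 !KE ui0 ui1 /K !eqxx inord2_eq//=.
by move: (h i0) (h i1) (g iz) => *; ring.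
Qed.

Lemma martinet_RabE (R : realType) (V f : 'rV[R]_3 -> R) (x : 'rV[R]_3) :
  smooth V ->
  let w := half_sq R x in let y := coord R iy x in
  let A1f := pd ix f x + w * pd iz f x in
  let A1V := pd ix V x + w * pd iz V x in
  Rab (@martinet_a R) V f x
  = pd iz f x * A1f + y * A1V * pd iz f x * pd iy f x
    + y * pd iz V x * A1f * pd iy f x
    + (pd ix (pd ix V) x + 2 * w * pd ix (pd iz V) x
       + w ^+ 2 * pd iz (pd iz V) x) * A1f ^+ 2
    + 2 * (pd ix (pd iy V) x + w * pd iy (pd iz V) x) * A1f * pd iy f x
    + pd iy (pd iy V) x * pd iy f x ^+ 2
    - y * pd iy V x * pd iz f x * A1f.
Proof.
move=> Vs w y A1f A1V.
rewrite /Rab (martinet_Rab_quadratic _ (fun r => pd r f x)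
  (fun k => fA (@martinet_a R) k f x)) sum2 !sum33 !martinet_fA1 !martinet_fA2.
rewrite !martinet_alE !martinet_pdE !pd_martinet_drift// !martinet_driftE_at.
rewrite !martinet_pdE -[martinet_A1 f x]/A1f -[martinet_A2 f x]/(pd iy f x) /=.
rewrite /A1f /A1V -/w -/y.
(* From here w and y are independent variables, their relation having entered through
   [pd_iy_half_sq]. *)
move: (w) (y) (pdC _ _ iy ix Vs) (pdC _ _ iz ix Vs) (pdC _ _ iz iy Vs).
move: (@pd R) ix iy iz => d jx jy jz w' y' -> -> ->.
by field.
Qed.

(** The [Q]-square of [Lambda1] is half of the square of [D], which leaves the [Gamma1z] term. The
    [P]-square of [Lambda2] has entries -y A2 f and y A1 f, which gives the [Gamma1] term. *)
Lemma martinet_RabGE (R : realType) (V f : 'rV[R]_3 -> R) (x : 'rV[R]_3) :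
  smooth V ->
  let w := half_sq R x in let y := x 0 iy in
  let A1f := pd ix f x + w * pd iz f x in
  let A1V := pd ix V x + w * pd iz V x in
  RabG (@martinet_a R) (@martinet_z R) V (martinet_Lambda1 f)
    (martinet_Lambda2 f) f x
  = y ^+ 2 / 2 * pd iz f x ^+ 2 - y ^+ 2 * (A1f ^+ 2 + pd iy f x ^+ 2)
    + pd iz f x * A1f + y * A1V * pd iz f x * pd iy f x
    + y * pd iz V x * A1f * pd iy f x
    + (pd ix (pd ix V) x + 2 * w * pd ix (pd iz V) x
       + w ^+ 2 * pd iz (pd iz V) x) * A1f ^+ 2
    + 2 * (pd ix (pd iy V) x + w * pd iy (pd iz V) x) * A1f * pd iy f x
    + pd iy (pd iy V) x * pd iy f x ^+ 2
    - y * pd iy V x * pd iz f x * A1f.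
Proof.
move=> Vs w y A1f A1V; rewrite /RabG martinet_RabE// martinet_QE martinet_PE.
rewrite martinet_Dsqr martinet_Esqr /martinet_Lambda1 /martinet_Lambda2.
rewrite ![(trmx _) _ _]mxE ![(\row_u _) _ _]mxE !inordK//=.
rewrite /A1f /A1V /w -[coord R iy x]/y /half_sq -/y.
move: (y).
move: (@pd R) ix iy iz => d jx jy jz y'.
by field.
Qed.

(** * Second derivatives along the fields, and the Hessian norm *)

Lemma martinet_words (R : realType) (f : 'rV[R]_3 -> R) (x : 'rV[R]_3) :
  smooth f ->
  let w := half_sq R x in let y := x 0 iy in
  let A1 := @martinet_A1 R in let A2 := @martinet_A2 R in
  let Z := @martinet_Z R in
  (A1 (A1 f) x = pd ix (pd ix f) x + 2 * w * pd ix (pd iz f) x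
                 + w ^+ 2 * pd iz (pd iz f) x)
  * (A1 (A2 f) x = pd ix (pd iy f) x + w * pd iy (pd iz f) x)
  * (A2 (A1 f) x = pd ix (pd iy f) x + y * pd iz f x + w * pd iy (pd iz f) x)
  * (A2 (A2 f) x = pd iy (pd iy f) x)
  * (A1 (Z f) x = pd ix (pd iz f) x + w * pd iz (pd iz f) x)
  * (A2 (Z f) x = pd iy (pd iz f) x).
Proof.
move=> fs w y A1 A2 Z.
have E12 : A1 (A2 f) x = pd ix (pd iy f) x + w * pd iy (pd iz f) x.
  by rewrite -(pdC _ _ iz iy fs).
have E21 : A2 (A1 f) x = A1 (A2 f) x + y * pd iz f x.
  by rewrite [A2 _](martinet_comm21 _ _ fs).
have E11 : A1 (A1 f) x = pd ix (pd ix f) x + 2 * w * pd ix (pd iz f) x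
                         + w ^+ 2 * pd iz (pd iz f) x.
  have P p : pd p (A1 f) x = pd p (pd ix f) x
      + (pd p (half_sq R) x * pd iz f x + w * pd p (pd iz f) x).
    by rewrite [pd p _](pd_martinet_A1 _ _ p fs).
  rewrite -[LHS]/(pd ix (A1 f) x + w * pd iz (A1 f) x) (P ix) (P iz).
  rewrite pd_ix_half_sq pd_iz_half_sq; move: (w) (pdC _ _ iz ix fs); clear.
  by move: (@pd R) ix iz => d jx jz v ->; rewrite /cst; ring.
have E21' : A2 (A1 f) x
    = pd ix (pd iy f) x + y * pd iz f x + w * pd iy (pd iz f) x.
  apply: (etrans E21); apply: (etrans (congr1 (+%R^~ _) E12)).
  exact: addrAC.
exact: (E11, E12, E21', erefl, erefl, erefl).
Qed.

Lemma XvecE (R : realType) (f : 'rV[R]_3 -> R) (x : 'rV[R]_3) :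
  (Xvec f x (@inord 8 0) 0 = pd ix (pd ix f) x)
  * (Xvec f x (@inord 8 1) 0 = pd ix (pd iy f) x)
  * (Xvec f x (@inord 8 2) 0 = pd ix (pd iz f) x)
  * (Xvec f x (@inord 8 3) 0 = pd iy (pd ix f) x)
  * (Xvec f x (@inord 8 4) 0 = pd iy (pd iy f) x)
  * (Xvec f x (@inord 8 5) 0 = pd iy (pd iz f) x)
  * (Xvec f x (@inord 8 6) 0 = pd iz (pd ix f) x)
  * (Xvec f x (@inord 8 7) 0 = pd iz (pd iy f) x)
  * (Xvec f x (@inord 8 8) 0 = pd iz (pd iz f) x).
Proof.
have E k : (k < 9)%N -> Xvec f x (inord k) 0
    = pd (inord (k %/ 3)) (pd (inord (k %% 3)) f) x.
  by move=> k9; rewrite mxE fst3E ?snd3E.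
exact: (E 0 isT, E 1 isT, E 2 isT, E 3 isT, E 4 isT, E 5 isT, E 6 isT, E 7 isT,
  E 8 isT)%N.
Qed.

(** [Lambda1] replaces A1 A2 f and A2 A1 f by their mean, whence the doubled square. [Lambda2]
    completes the squares of A1 Z f and A2 Z f, absorbing the cross terms of the Bochner formula. *)
Lemma martinet_HessG2E (R : realType) (f : 'rV[R]_3 -> R) (x : 'rV[R]_3) :
  smooth f ->
  let w := half_sq R x in let y := x 0 iy in
  HessG2 (@martinet_a R) (@martinet_z R) (martinet_Lambda1 f)
    (martinet_Lambda2 f) f x
  = (pd ix (pd ix f) x + 2 * w * pd ix (pd iz f) x
     + w ^+ 2 * pd iz (pd iz f) x) ^+ 2
    + (pd ix (pd iy f) x + y * pd iz f x / 2 + w * pd iy (pd iz f) x) ^+ 2 *+ 2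
    + pd iy (pd iy f) x ^+ 2
    + (pd ix (pd iz f) x - y * pd iy f x + w * pd iz (pd iz f) x) ^+ 2
    + (pd iy (pd iz f) x + y * (pd ix f x + w * pd iz f x)) ^+ 2.
Proof.
move=> fs w y; rewrite /HessG2 martinet_QE martinet_PE.
rewrite ![(Xvec _ _ + _) _ _]mxE !XvecE.
rewrite /martinet_Lambda1 /martinet_Lambda2.
rewrite ![(trmx _) _ _]mxE ![(\row_u _) _ _]mxE !inordK; [|by []..].
rewrite /=.
rewrite /w /half_sq -/y.
move: (y) (pdC _ _ iy ix fs) (pdC _ _ iz ix fs) (pdC _ _ iz iy fs).
move: (@pd R) ix iy iz => d jx jy jz v -> -> ->.
by field.
Qed.

Theorem proposition4p7 (R : realType) (V : 'rV[R]_3 -> R)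
    (V_smooth : smooth V)
    (c_finite : (norm_const V (@martinet_vol R) < +oo)%E)
    (f : 'rV[R]_3 -> R) (f_smooth : smooth f) :
  let a := @martinet_a R in
  let z := @martinet_z R in
  let rho := rho_star V (@martinet_vol R) in
  let L1 := martinet_Lambda1 f in
  let L2 := martinet_Lambda2 f in
  let A1 := @martinet_A1 R in
  let A2 := @martinet_A2 R in
  let Z := @martinet_Z R in
  forall x : 'rV[R]_3,
  let y := x 0 iy in
  [/\ Gamma2 a V f x + Gamma2z a z V rho f x
      = HessG2 a z L1 L2 f x + RabG a z V L1 L2 f x
        + Rzb a z V f x + Rrho a z rho f x,
      RabG a z V L1 L2 f x
      = y ^+ 2 / 2 * Gamma1z z f f x - y ^+ 2 * Gamma1 a f f x
        + pd iz f x * A1 f x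
        + y * A1 V x * pd iz f x * A2 f x
        + y * pd iz V x * A1 f x * A2 f x
        + (pd ix (pd ix V) x + y ^+ 2 * pd ix (pd iz V) x
           + y ^+ 4 / 4 * pd iz (pd iz V) x) * `|A1 f x| ^+ 2
        + 2 * (pd ix (pd iy V) x + y ^+ 2 / 2 * pd iy (pd iz V) x)
            * A1 f x * A2 f x
        + pd iy (pd iy V) x * `|A2 f x| ^+ 2
        - y * pd iy V x * pd iz f x * A1 f x,
      Rzb a z V f x
      = (pd ix (pd iz V) x + y ^+ 2 / 2 * pd iz (pd iz V) x) * A1 f x * Z f x
        + pd iy (pd iz V) x * A2 f x * Z f x
    & Rrho a z rho f x = 0].
Proof.
move=> a z rho L1 L2 A1 A2 Z x y.
split; [| |exact: martinet_RzbE|exact: martinet_RrhoE].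
- rewrite (martinet_Gamma_sum _ V rho f x V_smooth f_smooth).
  rewrite (martinet_RrhoE _ rho f x) (martinet_RzbE _ V f x V_smooth).
  rewrite (martinet_RabGE _ V f x V_smooth) (martinet_HessG2E _ f x f_smooth).
  (* Both sides become polynomials in first derivatives and in second derivatives with sorted
     indices, so no symmetry is left to apply. *)
  rewrite !(martinet_words _ f x f_smooth) !(martinet_words _ V x V_smooth).
  rewrite -![martinet_A1 _ x]/(pd ix _ x + half_sq R x * pd iz _ x).
  rewrite -![martinet_A2 _ x]/(pd iy _ x) -![martinet_Z _ x]/(pd iz _ x).
  rewrite /half_sq -/y; move: (y); move: (@pd R) ix iy iz => d jx jy jz v.
  by field.
(* It remains to unfold the Gamma forms and the fields, and to turn squared absolute values into
   squares. *)
- rewrite (martinet_RabGE _ V f x V_smooth) /Gamma1 sum2 !martinet_fA1.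
  rewrite !martinet_fA2 /Gamma1z martinet_fZ !real_normK ?num_real//.
  rewrite -![A1 _ x]/(pd ix _ x + half_sq R x * pd iz _ x).
  rewrite -![martinet_A1 _ x]/(pd ix _ x + half_sq R x * pd iz _ x).
  rewrite -![A2 _ x]/(pd iy _ x) -![martinet_A2 _ x]/(pd iy _ x).
  rewrite -![martinet_Z _ x]/(pd iz _ x) /half_sq -/y.
  move: (y); move: (@pd R) ix iy iz => d jx jy jz v.
  by field.
Qed.
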